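(* Let $\mathcal{A}$ be a unital real $C^*$-algebra, $\mathcal{H}$ a real Hilbert space and $\Phi\in\mathrm{UCP}_{C^*-ext}(\mathcal{A},\mathscr{B}(\mathcal{H}))$. If $\Phi(\mathcal{A})\subseteq\mathcal{K}(\mathcal{H})+\mathbb{R}\cdot I$, where $\mathcal{K}(\mathcal{H})$ denotes the compact operators on $\mathcal{H}$, then $\Phi\in\mathrm{UCP}_{ext}(\mathcal{A},\mathscr{B}(\mathcal{H}))$. In particular, if $\dim(\mathcal{H})<\infty$, then $\mathrm{UCP}_{C^*-ext}(\mathcal{A},\mathscr{B}(\mathcal{H}))\subseteq\mathrm{UCP}_{ext}(\mathcal{A},\mathscr{B}(\mathcal{H}))$.
   Context: All linear maps are real linear. A real $C^*$-algebra is a real Banach $*$-algebra with $\|a^*a\|=\|a\|^2$ and $1+a^*a$ invertible in the unitization for all $a$. An element is positive if it is of the form $b^*b$. For a real Hilbert space $\mathcal{H}$, $\mathscr{B}(\mathcal{H})$ is the algebra of bounded real linear operators. A real linear $\Phi:\mathcal{A}\to\mathscr{B}(\mathcal{H})$ is completely positive (CP) if $\sum_{i,j=1}^nT_i^*\Phi(a_i^*a_j)T_j\ge0$ for all finite families $a_j\in\mathcal{A}$, $T_j\in\mathscr{B}(\mathcal{H})$. $\mathrm{UCP}(\mathcal{A},\mathscr{B}(\mathcal{H}))$ is the set of CP maps with $\Phi(1)=I$. $\mathrm{Ad}_T(X)=T^*XT$. $\Phi\in\mathrm{UCP}(\mathcal{A},\mathscr{B}(\mathcal{H}))$ is a $C^*$-extreme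 point (written $\Phi\in\mathrm{UCP}_{C^*-ext}(\mathcal{A},\mathscr{B}(\mathcal{H}))$) if whenever $\Phi=\sum_{j=1}^n\mathrm{Ad}_{T_j}\circ\Phi_j$ with $\Phi_j\in\mathrm{UCP}(\mathcal{A},\mathscr{B}(\mathcal{H}))$ and invertible $T_j\in\mathscr{B}(\mathcal{H})$ satisfying $\sum_jT_j^*T_j=I$, then for every $j$ there is a unitary $U_j\in\mathscr{B}(\mathcal{H})$ with $\Phi_j=\mathrm{Ad}_{U_j}\circ\Phi$. It is a linear extreme point (written $\Phi\in\mathrm{UCP}_{ext}(\mathcal{A},\mathscr{B}(\mathcal{H}))$) if whenever $\Phi=\sum_{j=1}^nt_j\Phi_j$ with $\Phi_j\in\mathrm{UCP}(\mathcal{A},\mathscr{B}(\mathcal{H}))$, $t_j\in(0,1)$, $\sum_jt_j=1$, then $\Phi_j=\Phi$ for all $j$. *)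

(* Defs.v *)
From HB Require Import structures.
From mathcomp Require Import all_boot all_order all_algebra.
From mathcomp Require Import all_classical all_reals all_analysis.
From mathcomp Require Import ring lra.

Set Implicit Arguments.
Unset Strict Implicit.
Unset Printing Implicit Defensive.

Import Order.TTheory GRing.Theory Num.Theory.
Import numFieldNormedType.Exports.

Local Open Scope classical_set_scope.
Local Open Scope ring_scope.

(* The product is part of this structure because the library cannot join
   normed modules with rings (the only join is [numDomainType]).  The algebra
   is unital, so the unitization in which 1 + a^* a is required to be
   invertible is the algebra itself. *)
HB.mixin Record isRealCstarAlgebra (R : realType) A
    of CompleteNormedModule R A := {
  amul : A -> A -> A;
  aone : A;
  astar : A -> A;
  amulA : forall a b c : A, amul a (amul b c) = amul (amul a b) c;
  amul1l : forall a : A, amul aone a = a;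
  amul1r : forall a : A, amul a aone = a;
  amul_linearl : forall (k : R) (a b c : A),
    amul (k *: a + b) c = k *: amul a c + amul b c;
  amul_linearr : forall (k : R) (a b c : A),
    amul a (k *: b + c) = k *: amul a b + amul a c;
  astarK : forall a : A, astar (astar a) = a;
  astarM : forall a b : A, astar (amul a b) = amul (astar b) (astar a);
  astar_linear : forall (k : R) (a b : A),
    astar (k *: a + b) = k *: astar a + astar b;
  anormM : forall a b : A, `|amul a b| <= `|a| * `|b|;
  anorm_Cstar : forall a : A, `|amul (astar a) a| = `|a| ^+ 2;
  ainvertible : forall a : A, exists b : A,
    amul b (aone + amul (astar a) a) = aone /\
    amul (aone + amul (astar a) a) b = aone
}.

#[short(type="realCstarAlgType")]
HB.structure Definition RealCstarAlgebra (R : realType) :=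
  {A of CompleteNormedModule R A & isRealCstarAlgebra R A}.

HB.mixin Record isHilbert (R : realType) H of CompleteNormedModule R H := {
  inner : H -> H -> R;
  innerC : forall x y : H, inner x y = inner y x;
  inner_linearl : forall (k : R) (x y z : H),
    inner (k *: x + y) z = k * inner x z + inner y z;
  inner_norm : forall x : H, inner x x = `|x| ^+ 2
}.

#[short(type="hilbertType")]
HB.structure Definition Hilbert (R : realType) :=
  {H of CompleteNormedModule R H & isHilbert R H}.

Section HilbertTheory.
Variables (R : realType) (H : hilbertType R).
Implicit Types (x y z : H) (k : R).

Lemma innerDl x y z : inner (x + y) z = inner x z + inner y z.
Proof. by rewrite -[x]scale1r inner_linearl mul1r scale1r. Qed.

Lemma inner0l z : inner 0 z = 0.
Proof. by apply: (addrI (inner 0 z)); rewrite -innerDl !addr0. Qed.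

Lemma innerZl k x z : inner (k *: x) z = k * inner x z.
Proof. by rewrite -[k *: x]addr0 inner_linearl inner0l addr0. Qed.

Lemma innerDr x y z : inner x (y + z) = inner x y + inner x z.
Proof. by rewrite innerC innerDl ![inner _ x]innerC. Qed.

Lemma innerZr k x z : inner x (k *: z) = k * inner x z.
Proof. by rewrite innerC innerZl innerC. Qed.

Lemma innerNl x z : inner (- x) z = - inner x z.
Proof. by rewrite -scaleN1r innerZl mulN1r. Qed.

Lemma innerNr x z : inner x (- z) = - inner x z.
Proof. by rewrite innerC innerNl innerC. Qed.

Lemma inner_injr y z : (forall x, inner x y = inner x z) -> y = z.
Proof.
move=> h; apply/eqP; rewrite -subr_eq0 -normr_eq0 -sqrf_eq0 -inner_norm.
by rewrite innerDr innerNr h subrr.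
Qed.

Lemma CauchySchwarz x y : inner x y <= `|x| * `|y|.
Proof.
have [->|x0] := eqVneq x 0; first by rewrite inner0l normr0 mul0r.
have [->|y0] := eqVneq y 0; first by rewrite innerC inner0l normr0 mulr0.
have nx : 0 < `|x| by rewrite normr_gt0.
have ny : 0 < `|y| by rewrite normr_gt0.
have : 0 <= `| (`|y| *: x - `|x| *: y) | ^+ 2 by exact: sqr_ge0.
rewrite -inner_norm !(innerDl, innerDr, innerNl, innerNr, innerZl, innerZr).
rewrite (innerC y x) !inner_norm.
have nxy : 0 < `|x| * `|y| by rewrite mulr_gt0.
move=> h; rewrite -(ler_pM2l nxy); nra.
Qed.

Lemma Riesz (f : H -> R) (M : R) :
  (forall k x y, f (k *: x + y) = k * f x + f y) ->
  (forall x, `|f x| <= M * `|x|) -> exists y, forall x, f x = inner x y.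
Proof.
move=> fl fM.
have fD x y : f (x + y) = f x + f y.
  by rewrite -[x]scale1r fl mul1r scale1r.
have f0 : f 0 = 0 by apply: (addrI (f 0)); rewrite -fD !addr0.
have fZ k x : f (k *: x) = k * f x by rewrite -[k *: x]addr0 fl f0 addr0.
have fN x : f (- x) = - f x by rewrite -scaleN1r fZ mulN1r.
pose I x : R := `|x| ^+ 2 - 2 * f x.
have Ilb x : - M ^+ 2 <= I x.
  have := fM x; rewrite ler_norml /I => /andP[_ h].
  have : 0 <= (`|x| - M) ^+ 2 by exact: sqr_ge0.
  nra.
pose m := inf (range I).
have hm : has_inf (range I).
  split; first by exists (I 0), 0.
  by exists (- M ^+ 2) => _ [x _ <-].
have mI x : m <= I x.
  by apply: ge_inf; [exact: hm.2|exists x].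
have par x y : `|x - y| ^+ 2 <= 2 * (I x - m) + 2 * (I y - m).
  have := mI (2^-1 *: (x + y)).
  rewrite /I -!inner_norm !(innerDl, innerDr, innerNl, innerNr).
  rewrite !(innerZl, innerZr) !(innerDl, innerDr) fZ fD (innerC y x).
  lra.
have /choice[u hu] : forall n : nat, exists x, I x < m + n.+1%:R^-1.
  move=> n.
  have e0 : 0 < n.+1%:R^-1 :> R by rewrite invr_gt0.
  have [_ [x _ <-] h] := inf_adherent e0 hm.
  by exists x.
have cu : cvgn u.
  apply/cauchy_cvgP/cauchy_ballP => /= e e0.
  have e4 : 0 < e ^+ 2 / 4 by rewrite divr_gt0// exprn_gt0.
  have [N _ hN] := near_infty_natSinv_lt (PosNum e4).
  exists ([set u n | n in [set n | (N <= n)%N]],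
          [set u n | n in [set n | (N <= n)%N]]) => /=.
    by split; exists N => // n /= Nn; exists n.
  move=> [_ _] /= [[p Np <-] [q Nq <-]].
  rewrite -ball_normE /ball_ /=.
  rewrite -(@ltr_pXn2r _ 2) ?nnegrE ?(ltW e0)//.
  apply: (le_lt_trans (par _ _)).
  have := hN p Np; have := hN q Nq; rewrite /= => h1 h2.
  have := hu p; have := hu q => h3 h4.
  move: (e ^+ 2) (p.+1%:R^-1) (q.+1%:R^-1) h1 h2 h3 h4 => /= E P Q.
  lra.
pose y := limn u.
have uy : u @ \oo --> y by exact: cu.
have Iy : I y <= m.
  apply/ler_addgt0Pr => /= e e0.
  (* compare I y with I (u n) for n large *)
  pose C : R := 2 * `|y| + 1 + 2 * `|M|.
  have C0 : 0 < C.
    by rewrite /C; have := normr_ge0 y; have := normr_ge0 M; lra.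
  have d0 : 0 < Num.min 1 (e / 2 / C).
    by rewrite lt_min ltr01 !divr_gt0.
  have e2 : 0 < e / 2 by rewrite divr_gt0.
  move/cvgrPdist_lt : uy => /(_ _ d0) h1.
  have h2 := near_infty_natSinv_lt (PosNum e2).
  near \oo => n.
  have : `|y - u n| < Num.min 1 (e / 2 / C) by near: n.
  rewrite lt_min => /andP[d1 d2].
  have s : n.+1%:R^-1 < e / 2 by near: n; exact: h2.
  have In := hu n.
  suff : I y - I (u n) <= C * `|y - u n|.
    have : C * `|y - u n| < e / 2 by rewrite mulrC -ltr_pdivlMr.
    have aux (a b S D : R) : S < e / 2 -> b < m + S -> D < e / 2 ->
      a - b <= D -> a <= m + e by lra.
    exact: aux s In.
  have Q : `|y| ^+ 2 - `|u n| ^+ 2 = 2 * inner (y - u n) y - `|y - u n| ^+ 2.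
    rewrite -!inner_norm !(innerDl, innerDr, innerNl, innerNr).
    rewrite (innerC (u n) y).
    ring.
  have F : f y - f (u n) = f (y - u n) by rewrite fD fN.
  have := CauchySchwarz (y - u n) y.
  have := fM (y - u n); rewrite ler_norml => /andP[+ _].
  have : M * `|y - u n| <= `|M| * `|y - u n|.
    by apply: ler_wpM2r => //; exact: ler_norm.
  have := sqr_ge0 `|y - u n|; have := normr_ge0 (y - u n).
  rewrite /I /C; nra.
exists y => x.
have quad t : 0 <= t ^+ 2 * `|x| ^+ 2 + 2 * t * (inner x y - f x).
  have := mI (t *: x + y); have : I y <= m by [].
  rewrite /I -!inner_norm fl !(innerDl, innerDr, innerZl, innerZr).
  rewrite (innerC y x).
  lra.
set b := inner x y - f x in quad.
suff : b = 0 by rewrite /b => /eqP; rewrite subr_eq0 => /eqP.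
have := quad (- b / (`|x| ^+ 2 + 1)).
have X0 : 0 < `|x| ^+ 2 + 1 by have := sqr_ge0 `|x|; lra.
set X := `|x| ^+ 2 in X0 *.
have X1 : X + 1 != 0 by rewrite gt_eqF.
have -> : (- b / (X + 1)) ^+ 2 * X + 2 * (- b / (X + 1)) * b =
  - (b ^+ 2 * ((X + 2) / (X + 1) ^+ 2)) by field.
have X2 : 0 < (X + 2) / (X + 1) ^+ 2.
  by rewrite divr_gt0 ?exprn_gt0//; lra.
rewrite oppr_ge0 pmulr_lle0// => b2.
by apply/eqP; rewrite -sqrf_eq0 eq_le b2 sqr_ge0.
Unshelve. all: by end_near.
Qed.

End HilbertTheory.

Record bounded_operator (R : realType) (H : hilbertType R) := BoundedOperator {
  bop_fun :> H -> H;
  bop_linear : linear bop_fun;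
  bop_bounded : exists M : R, forall x, `|bop_fun x| <= M * `|x|
}.
Arguments BoundedOperator {R H}.

Notation "''B' ( H )" := (bounded_operator H)
  (at level 8, format "''B' ( H )") : type_scope.

Section BoundedOperators.
Variables (R : realType) (H : hilbertType R).
Implicit Types (S T : 'B(H)) (k : R).

HB.instance Definition _ := gen_eqMixin 'B(H).
HB.instance Definition _ := gen_choiceMixin 'B(H).

Lemma bopP S T : (forall x, S x = T x) -> S = T.
Proof.
case: S T => [f fl fb] [g gl gb] /= /funext fg.
by subst g; congr BoundedOperator; exact: Prop_irrelevance.
Qed.

Lemma bopD T x y : T (x + y) = T x + T y.
Proof. by rewrite -[x]scale1r bop_linear !scale1r. Qed.

Lemma bop0 T : T 0 = 0.
Proof. by apply: (addrI (T 0)); rewrite -bopD !addr0. Qed.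

Lemma bopZ T k x : T (k *: x) = k *: T x.
Proof. by rewrite -[k *: x]addr0 bop_linear bop0 addr0. Qed.

Lemma bop_bound T :
  exists M : R, 0 <= M /\ forall x, `|T x| <= M * `|x|.
Proof.
have [M hM] := bop_bounded T; exists `|M|; split=> // x.
by apply: (le_trans (hM x)); apply: ler_wpM2r => //; exact: ler_norm.
Qed.

Lemma bop_zero_linear : linear (fun _ : H => 0 : H).
Proof. by move=> k x y; rewrite scaler0 addr0. Qed.

Lemma bop_zero_bounded : exists M : R, forall x : H, `|0 : H| <= M * `|x|.
Proof. by exists 0 => x; rewrite normr0 mul0r. Qed.

Definition bop_zero := BoundedOperator _ bop_zero_linear bop_zero_bounded.

Lemma bop_one_linear : linear (fun x : H => x).
Proof. by []. Qed.

Lemma bop_one_bounded : exists M : R, forall x : H, `|x| <= M * `|x|.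
Proof. by exists 1 => x; rewrite mul1r. Qed.

Definition bop_one := BoundedOperator _ bop_one_linear bop_one_bounded.

Lemma bop_add_linear S T : linear (fun x => S x + T x).
Proof. by move=> k x y; rewrite !bop_linear scalerDr addrACA. Qed.

Lemma bop_add_bounded S T :
  exists M : R, forall x, `|S x + T x| <= M * `|x|.
Proof.
have [M hM] := bop_bounded S; have [N hN] := bop_bounded T.
by exists (M + N) => x; rewrite mulrDl (le_trans (ler_normD _ _))// lerD.
Qed.

Definition bop_add S T :=
  BoundedOperator _ (bop_add_linear S T) (bop_add_bounded S T).

Lemma bop_scale_linear k T : linear (fun x => k *: T x).
Proof. by move=> l x y; rewrite bop_linear scalerDr !scalerA mulrC. Qed.

Lemma bop_scale_bounded k T :
  exists M : R, forall x, `|k *: T x| <= M * `|x|.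
Proof.
have [M hM] := bop_bounded T; exists (`|k| * M) => x.
by rewrite normrZ -mulrA ler_wpM2l.
Qed.

Definition bop_scale k T :=
  BoundedOperator _ (bop_scale_linear k T) (bop_scale_bounded k T).

Lemma bop_comp_linear S T : linear (fun x => S (T x)).
Proof. by move=> k x y; rewrite !bop_linear. Qed.

Lemma bop_comp_bounded S T :
  exists M : R, forall x, `|S (T x)| <= M * `|x|.
Proof.
have [M [M0 hM]] := bop_bound S; have [N hN] := bop_bounded T.
exists (M * N) => x; apply: (le_trans (hM _)).
by rewrite -mulrA ler_wpM2l.
Qed.

Definition bop_comp S T :=
  BoundedOperator _ (bop_comp_linear S T) (bop_comp_bounded S T).

Lemma bop_addA : associative bop_add.
Proof. by move=> S T U; apply: bopP => x /=; rewrite addrA. Qed.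
Lemma bop_addC : commutative bop_add.
Proof. by move=> S T; apply: bopP => x /=; rewrite addrC. Qed.
Lemma bop_add0 : left_id bop_zero bop_add.
Proof. by move=> S; apply: bopP => x /=; rewrite add0r. Qed.
Lemma bop_addN : left_inverse bop_zero (bop_scale (-1)) bop_add.
Proof. by move=> S; apply: bopP => x /=; rewrite scaleN1r addNr. Qed.

HB.instance Definition _ := GRing.isZmodule.Build 'B(H)
  bop_addA bop_addC bop_add0 bop_addN.

Lemma bop_compA : associative bop_comp.
Proof. by move=> S T U; apply: bopP. Qed.
Lemma bop_comp1l : left_id bop_one bop_comp.
Proof. by move=> S; apply: bopP. Qed.
Lemma bop_comp1r : right_id bop_one bop_comp.
Proof. by move=> S; apply: bopP. Qed.
Lemma bop_compDl : left_distributive bop_comp +%R.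
Proof. by move=> S T U; apply: bopP. Qed.
Lemma bop_compDr : right_distributive bop_comp +%R.
Proof. by move=> S T U; apply: bopP => x /=; rewrite bopD. Qed.

HB.instance Definition _ := GRing.Zmodule_isPzRing.Build 'B(H)
  bop_compA bop_comp1l bop_comp1r bop_compDl bop_compDr.

Lemma bop_scaleA k l T : bop_scale k (bop_scale l T) = bop_scale (k * l) T.
Proof. by apply: bopP => x /=; rewrite scalerA. Qed.
Lemma bop_scale1 : left_id 1 bop_scale.
Proof. by move=> T; apply: bopP => x /=; rewrite scale1r. Qed.
Lemma bop_scaleDr : right_distributive bop_scale +%R.
Proof. by move=> k S T; apply: bopP => x /=; rewrite scalerDr. Qed.
Lemma bop_scaleDl T : {morph bop_scale^~ T : k l / k + l}.
Proof. by move=> k l; apply: bopP => x /=; rewrite scalerDl. Qed.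

HB.instance Definition _ := GRing.Zmodule_isLmodule.Build R 'B(H)
  bop_scaleA bop_scale1 bop_scaleDr bop_scaleDl.

Lemma adjoint_exists T :
  exists S : 'B(H), forall x y, inner (T x) y = inner x (S y).
Proof.
have [M [M0 hM]] := bop_bound T.
have /choice[s hs] : forall y, exists z, forall x, inner (T x) y = inner x z.
  move=> y; apply: (@Riesz _ _ (fun x => inner (T x) y) (M * `|y|)).
    by move=> k x z; rewrite bop_linear inner_linearl.
  move=> x; have cs z : inner (T z) y <= M * `|y| * `|z|.
    apply: (le_trans (CauchySchwarz _ _)).
    by rewrite mulrAC ler_wpM2r.
  rewrite ler_norml cs andbT lerNl -innerNl -scaleN1r -bopZ scaleN1r.
  by rewrite -[X in _ <= _ * X]normrN cs.
have sl : linear s.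
  move=> k y z; apply: inner_injr => x.
  by rewrite -hs !innerDr !innerZr !hs.
have sb : exists N : R, forall y, `|s y| <= N * `|y|.
  exists M => y.
  have [->|s0] := eqVneq (s y) 0; first by rewrite normr0 mulr_ge0.
  have ns : 0 < `|s y| by rewrite normr_gt0.
  rewrite -(ler_pM2l ns) -expr2 -inner_norm -hs.
  apply: (le_trans (CauchySchwarz _ _)).
  by rewrite mulrCA mulrA ler_wpM2r.
by exists (BoundedOperator s sl sb).
Qed.

Definition adjoint T : 'B(H) := projT1 (cid (adjoint_exists T)).

Lemma adjointP T x y : inner (T x) y = inner x (adjoint T y).
Proof. exact: (projT2 (cid (adjoint_exists T))). Qed.

Definition invertible T := exists S : 'B(H), S * T = 1 /\ T * S = 1.

Definition unitary T := adjoint T * T = 1 /\ T * adjoint T = 1.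

(* Over the reals [forall x, 0 <= inner (T x) x] would not force T to be
   selfadjoint. *)
Definition positive T := exists S : 'B(H), T = adjoint S * S.

Definition Ad T (X : 'B(H)) : 'B(H) := adjoint T * X * T.

Definition compact_operator T :=
  precompact (T @` [set x : H | `|x| <= 1]).

End BoundedOperators.

Definition finite_dimensional (R : realType) (V : lmodType R) :=
  exists (n : nat) (e : 'I_n -> V),
    forall x : V, exists c : 'I_n -> R, x = \sum_(i < n) c i *: e i.

Section UCP.
Variables (R : realType) (A : realCstarAlgType R) (H : hilbertType R).

Definition completely_positive (Phi : {linear A -> 'B(H)}) :=
  forall (n : nat) (a : 'I_n -> A) (T : 'I_n -> 'B(H)),
    positive (\sum_(i < n) \sum_(j < n)
       adjoint (T i) * Phi (amul (astar (a i)) (a j)) * T j).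

Definition UCP : set {linear A -> 'B(H)} :=
  [set Phi | completely_positive Phi /\ Phi aone = 1].

Definition UCP_Cstar_ext : set {linear A -> 'B(H)} :=
  [set Phi | UCP Phi /\
    forall (n : nat) (Psi : 'I_n -> {linear A -> 'B(H)}) (T : 'I_n -> 'B(H)),
      (forall j, UCP (Psi j)) -> (forall j, invertible (T j)) ->
      \sum_(j < n) adjoint (T j) * T j = 1 ->
      (forall a, Phi a = \sum_(j < n) Ad (T j) (Psi j a)) ->
      forall j, exists U : 'B(H), unitary U /\ Psi j =1 Ad U \o Phi].

Definition UCP_ext : set {linear A -> 'B(H)} :=
  [set Phi | UCP Phi /\
    forall (n : nat) (Psi : 'I_n -> {linear A -> 'B(H)}) (t : 'I_n -> R),
      (forall j, UCP (Psi j)) -> (forall j, 0 < t j < 1) ->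
      \sum_(j < n) t j = 1 ->
      (forall a, Phi a = \sum_(j < n) t j *: Psi j a) ->
      forall j, Psi j =1 Phi].

End UCP.
Arguments UCP {R} A H.
Arguments UCP_Cstar_ext {R} A H.
Arguments UCP_ext {R} A H.

(* Main.v *)
(** If Phi = sum_j t_j Psi_j, C*-extremality applied to the operators
    t_j^(1/2) I gives unitaries U_j with Psi_j = Ad_{U_j} o Phi.  Writing
    Phi(a) = K + c I with K compact, one gets K = sum_j t_j U_j^* K U_j, and
    everything reduces to showing that each U_j commutes with K.  By strict
    convexity of the norm this holds on the vectors at which |K x| / |x| is
    maximal, over H or over any subspace reducing all the U_j; compactness
    makes the set of these vectors nonzero and invariant under U_j^*. *)

Require Import Defs.
From HB Require Import structures.
From mathcomp Require Import all_boot all_order all_algebra.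
From mathcomp Require Import all_classical all_reals all_analysis.
From mathcomp Require Import ring lra.

Set Implicit Arguments.
Unset Strict Implicit.
Unset Printing Implicit Defensive.

Import Order.TTheory GRing.Theory Num.Theory.
Import numFieldNormedType.Exports.

Local Open Scope classical_set_scope.
Local Open Scope ring_scope.

(** * Norm identities, unitaries and cluster points of compact operators *)

Section HilbertSpace.
Variables (R : realType) (H : hilbertType R).
Implicit Types (x y z w : H) (S T U : 'B(H)).

Lemma inner_suml (I : finType) (v : I -> H) z :
  inner (\sum_i v i) z = \sum_i inner (v i) z.
Proof.
by apply: (big_morph (fun x => inner x z)) => [x y|];
  [exact: innerDl|exact: inner0l].
Qed.

Lemma inner_eq0 x : inner x x = 0 -> x = 0.
Proof. by move/eqP; rewrite inner_norm sqrf_eq0 normr_eq0 => /eqP. Qed.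

Lemma normB_sqr x y : `|x - y| ^+ 2 = `|x| ^+ 2 - 2 * inner x y + `|y| ^+ 2.
Proof.
rewrite -!inner_norm !(innerDl, innerDr, innerNl, innerNr) (innerC y x); ring.
Qed.

Lemma parallelogram x y :
  `|x + y| ^+ 2 + `|x - y| ^+ 2 = 2 * `|x| ^+ 2 + 2 * `|y| ^+ 2.
Proof.
rewrite -!inner_norm !(innerDl, innerDr, innerNl, innerNr) (innerC y x); ring.
Qed.

(** Strict convexity of the norm: the sum of [t i * |v i - w|^2] equals the sum of [t i * |v i|^2]
    minus [|w|^2], which is at most 0. *)
Lemma convex_comb_extreme (I : finType) (t : I -> R) (v : I -> H) w :
  (forall i, 0 < t i) -> \sum_i t i = 1 -> w = \sum_i t i *: v i ->
  (forall i, `|v i| <= `|w|) -> forall i, v i = w.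
Proof.
move=> t0 t1 wE vw.
have ge0 i : true -> 0 <= t i * `|v i - w| ^+ 2.
  by move=> _; rewrite mulr_ge0 ?sqr_ge0// ltW.
have : \sum_i t i * `|v i - w| ^+ 2 <= 0.
  have -> : \sum_i t i * `|v i - w| ^+ 2 =
      \sum_i t i * `|v i| ^+ 2 - 2 * inner w w + `|w| ^+ 2.
    have -> : `|w| ^+ 2 = \sum_i t i * `|w| ^+ 2 by rewrite -mulr_suml t1 mul1r.
    rewrite {2}wE inner_suml mulr_sumr -sumrB -big_split /=; apply: eq_bigr => i _.
    by rewrite normB_sqr innerZl; ring.
  have : \sum_i t i * `|v i| ^+ 2 <= \sum_i t i * `|w| ^+ 2.
    apply: ler_sum => i _; rewrite ler_wpM2l ?(ltW (t0 i))//.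
    by rewrite ler_pXn2r ?nnegrE.
  by rewrite -mulr_suml t1 inner_norm; lra.
rewrite le_eqVlt ltNge sumr_ge0// orbF => /eqP s0 i.
have /eqP := psumr_eq0P ge0 s0 (isT : xpredT i).
by rewrite mulf_eq0 gt_eqF//= sqrf_eq0 normr_eq0 subr_eq0 => /eqP.
Qed.

Lemma bopN T x : T (- x) = - T x.
Proof. by rewrite -scaleN1r bopZ scaleN1r. Qed.

Lemma bopB T x y : T (x - y) = T x - T y.
Proof. by rewrite bopD bopN. Qed.

Lemma bop_sumE (I : finType) (F : I -> 'B(H)) x :
  (\sum_i F i) x = \sum_i F i x.
Proof. by apply: (big_morph (fun T : 'B(H) => T x)). Qed.

Lemma adjointPr T x y : inner x (T y) = inner (adjoint T x) y.
Proof. by rewrite innerC adjointP innerC. Qed.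

Lemma adjoint1 : adjoint (1 : 'B(H)) = 1.
Proof. by apply: bopP => y; apply: inner_injr => x; rewrite -adjointP. Qed.

Lemma adjointZ (k : R) T : adjoint (k *: T) = k *: adjoint T.
Proof.
apply: bopP => y; apply: inner_injr => x.
by rewrite -adjointP innerZl innerZr adjointP.
Qed.

Lemma AdE T S x : Ad T S x = adjoint T (S (T x)).
Proof. by []. Qed.

Section Unitary.
Variables (U : 'B(H)) (uU : unitary U).

Lemma unitaryK : cancel U (adjoint U).
Proof. by move=> x; have := congr1 (fun T : 'B(H) => T x) uU.1. Qed.

Lemma unitaryKV : cancel (adjoint U) U.
Proof. by move=> x; have := congr1 (fun T : 'B(H) => T x) uU.2. Qed.

Lemma unitary_norm x : `|U x| = `|x|.
Proof.
apply/eqP; rewrite -(eqrXn2 (ltn0Sn 1))//; apply/eqP.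
by rewrite -!inner_norm adjointP unitaryK.
Qed.

Lemma unitary_norm_adjoint x : `|adjoint U x| = `|x|.
Proof. by rewrite -[in RHS](unitaryKV x) unitary_norm. Qed.

Lemma unitary_iter_norm k x : `|iter k U x| = `|x|.
Proof. by elim: k => //= k <-; rewrite unitary_norm. Qed.

End Unitary.

(** The images [T (u n)] stay in a compact set containing the image of the unit ball, so the filter
    of their tails has a cluster point. *)
Lemma compact_operator_cluster T (u : nat -> H) :
  compact_operator T -> (forall n, `|u n| <= 1) ->
  exists y, forall e N, 0 < e -> exists2 n, (N <= n)%N & `|T (u n) - y| < e.
Proof.
move=> [C Cball [Ccpt _]] u1.
have FC : ((T \o u) @ \oo) C.
  by exists 0 => // n _; apply: Cball; exists (u n) => //=.
have [y [_ yC]] := Ccpt _ _ FC.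
exists y => e N e0.
have tN : ((T \o u) @ \oo) [set T (u n) | n in [set n | (N <= n)%N]].
  by exists N => // n Nn; exists n.
have [_ [[n Nn <-] yn]] := yC _ _ tN (nbhsx_ballx y e e0).
by exists n => //; rewrite distrC; move: yn; rewrite -ball_normE.
Qed.

(* The parallelogram law applied to [x, y] and to [T x, T y]: near-maximizers
   of [|T x| / |x|] are as close to each other as their images are. *)
Lemma almost_isometric_near_norm T (M : set H) (s : R) x y :
  (forall x y, M x -> M y -> M (x + y)) -> 0 <= s ->
  (forall x, M x -> `|T x| <= s * `|x|) -> M x -> M y ->
  s ^+ 2 * `|x - y| ^+ 2 <= `|T x - T y| ^+ 2 +
    2 * (s ^+ 2 * `|x| ^+ 2 - `|T x| ^+ 2) +
    2 * (s ^+ 2 * `|y| ^+ 2 - `|T y| ^+ 2).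
Proof.
move=> MD s0 Ts Mx My.
have h : `|T x + T y| ^+ 2 <= s ^+ 2 * `|x + y| ^+ 2.
  rewrite -exprMn -bopD ler_pXn2r ?nnegrE ?mulr_ge0//.
  exact/Ts/MD.
have := parallelogram (T x) (T y).
have := congr1 (fun r => s ^+ 2 * r) (parallelogram x y).
rewrite !mulrDr; lra.
Qed.

End HilbertSpace.

(** * Norm-attaining vectors of a compact operator, and commutation with unitaries *)

Section Commutation.
Variables (R : realType) (H : hilbertType R).
Implicit Types (x y z w : H) (S T U K : 'B(H)) (M W : set H).

Lemma closureP_norm M z :
  closure M z <-> forall e, 0 < e -> exists2 x, M x & `|z - x| < e.
Proof.
split=> [cz e e0|h B /nbhs_ballP[e /= e0 zB]].
  have [x [Mx]] := cz _ (nbhsx_ballx z e e0).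
  by rewrite -ball_normE; exists x.
by have [x Mx zx] := h e e0; exists x; split=> //; apply: zB; rewrite -ball_normE.
Qed.

(** Along suitable indices the images of a maximizing sequence converge by compactness;
    [almost_isometric_near_norm] then makes the vectors themselves Cauchy, and their limit stays in
    the closed set [M]. *)
Lemma compact_operator_norm_attained T M (s : R) :
  compact_operator T -> closed M -> (forall x y, M x -> M y -> M (x + y)) ->
  0 < s -> (forall x, M x -> `|T x| <= s * `|x|) ->
  (forall e, 0 < e -> exists x, [/\ M x, `|x| <= 1 & s - e < `|T x|]) ->
  exists x, [/\ M x, x != 0 & `|T x| = s * `|x|].
Proof.
move=> cT cM MD s0 Ts approx.
pose d k : R := k.+1%:R^-1.
have d0 k : 0 < d k by rewrite invr_gt0.
have /choice[u hu] := fun k => approx (d k) (d0 k).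
have [|y hy] := compact_operator_cluster cT (u := u).
  by move=> k; have [] := hu k.
have /choice[f hf] : forall k, exists n,
    (k <= n)%N /\ `|T (u n) - y| < d k.
  by move=> k; have [n kn ny] := hy (d k) k (d0 k); exists n.
pose v k := u (f k).
have Mv k : M (v k) by have [] := hu (f k).
have v1 k : `|v k| <= 1 by have [] := hu (f k).
have Tv k : s - d k < `|T (v k)|.
  have [_ _] := hu (f k); apply: le_lt_trans; rewrite lerD2l lerN2.
  by rewrite /d lef_pV2 ?posrE// ler_nat ltnS; have [] := hf k.
have Tvy k : `|T (v k) - y| < d k by have [] := hf k.
have Tvs k : `|T (v k)| <= s.
  by apply: (le_trans (Ts _ (Mv k))); rewrite ler_piMr// ltW.
(* Since [|v k| <= 1], it suffices to bound [s - |T (v k)|] by [d k] and [s + |T (v k)|] by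
   [2 * s]. *)
have defect k : s ^+ 2 * `|v k| ^+ 2 - `|T (v k)| ^+ 2 <= 2 * s * d k.
  have : s ^+ 2 * `|v k| ^+ 2 <= s ^+ 2.
    by rewrite ler_piMr ?sqr_ge0// expr_le1.
  have := Tv k; have := Tvs k; have := d0 k; have := normr_ge0 (T (v k)).
  nra.
have dist p q : s ^+ 2 * `|v p - v q| ^+ 2 <=
    (d p + d q) ^+ 2 + 4 * s * (d p + d q).
  apply: (le_trans (almost_isometric_near_norm MD (ltW s0) Ts (Mv p) (Mv q))).
  have : `|T (v p) - T (v q)| ^+ 2 <= (d p + d q) ^+ 2.
    rewrite ler_pXn2r ?nnegrE ?addr_ge0 ?(ltW (d0 _))//.
    rewrite -[T (v p)](subrK y) -addrA (le_trans (ler_normD _ _))// lerD//.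
      exact: ltW.
    by rewrite distrC ltW.
  have := defect p; have := defect q; lra.
have dsmall e : 0 < e -> \forall k \near \oo, d k < e.
  by move=> e0; exact: (near_infty_natSinv_lt (PosNum e0)).
have cv : cvgn v.
  apply/cauchy_cvgP/cauchy_ballP => /= e e0.
  (* For [r = d p + d q < 2 * c] and [c <= 1], the bound [r^2 + 4 * s * r] is below
     [c * (4 + 8 * s)]. *)
  pose c : R := Num.min 1 (s ^+ 2 * e ^+ 2 / (4 + 8 * s)).
  have s8 : 0 < 4 + 8 * s by lra.
  have c0 : 0 < c by rewrite lt_min ltr01 divr_gt0 ?mulr_gt0 ?exprn_gt0.
  have [N _ hN] := dsmall _ c0.
  exists ([set v n | n in [set n | (N <= n)%N]],
          [set v n | n in [set n | (N <= n)%N]]) => /=.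
    by split; exists N => // n /= Nn; exists n.
  move=> [_ _] /= [[p Np <-] [q Nq <-]].
  rewrite -ball_normE /ball_ /=.
  rewrite -(@ltr_pXn2r _ 2) ?nnegrE ?(ltW e0)// -(ltr_pM2l (exprn_gt0 2 s0)).
  apply: (le_lt_trans (dist _ _)).
  have hp := hN p Np; have hq := hN q Nq.
  have c1 : c <= 1 by rewrite ge_min lexx.
  have c2 : c * (4 + 8 * s) <= s ^+ 2 * e ^+ 2.
    by rewrite -ler_pdivlMr// ge_min lexx orbT.
  apply: lt_le_trans c2.
  have := d0 p; have := d0 q; move: hp hq => /=.
  move: (d p) (d q) => P Q hP hQ Q0 P0.
  have : P + Q < 2 * c by lra.
  have : 0 < P + Q by lra.
  move: (P + Q) => r r0 rc.
  have : r ^+ 2 < 4 * c by nra.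
  nra.
pose z := limn v.
have near_z e : 0 < e -> exists2 k, `|z - v k| < e & d k < e.
  move=> e0; have /cvgrPdist_lt/(_ _ e0) h : v @ \oo --> z by exact: cv.
  have h2 := dsmall _ e0; near \oo => k.
  by exists k; near: k.
have Mz : M z.
  apply: cM; apply/closureP_norm => e /near_z[k zk _].
  by exists (v k).
have z1 : `|z| <= 1.
  apply/ler_addgt0Pr => e /near_z[k zk _].
  rewrite -[z](subrK (v k)) addrC (le_trans (ler_normD _ _))// lerD//.
  exact: ltW.
have [C [C0 TC]] := bop_bound T.
have Tz : s <= `|T z|.
  apply/ler_addgt0Pr => e e0.
  have C1 : 0 < 1 + C by lra.
  have [k zk dk] := near_z _ (divr_gt0 e0 C1).
  have : `|T (v k)| <= `|T z| + C * `|z - v k|.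
    rewrite -{1}(subKr z (v k)) bopB.
    by rewrite (le_trans (ler_normB _ _))// lerD2l.
  have := Tv k; have : C * `|z - v k| <= C * (e / (1 + C)).
    by rewrite ler_wpM2l// ltW.
  have : e / (1 + C) + C * (e / (1 + C)) = e by field; rewrite gt_eqF.
  move: dk; lra.
have zE : `|z| = 1.
  apply/eqP; rewrite eq_le z1 /=.
  by rewrite -(ler_pM2l s0) mulr1 (le_trans Tz)// Ts.
exists z; split=> //.
  by rewrite -normr_gt0 zE.
by apply/eqP; rewrite eq_le Ts//= zE mulr1.
Unshelve. all: by end_near.
Qed.

(* [U ^ n x] has a pair of terms that are arbitrarily close, because their
   images under [T] cluster and [T] is a multiple of an isometry on [M] along
   the orbit; applying the inverse of [U] enough times, some [U ^ k x] is
   arbitrarily close to [U ^-1 x]. *)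
Lemma norm_attained_unitary_inv T U M (s : R) x :
  compact_operator T -> unitary U ->
  (forall x y, M x -> M y -> M (x + y)) ->
  0 < s -> (forall x, M x -> `|T x| <= s * `|x|) ->
  (forall k, M (iter k U x)) -> M (adjoint U x) ->
  (forall k, `|T (iter k U x)| = s * `|x|) ->
  `|T (adjoint U x)| = s * `|adjoint U x|.
Proof.
move=> cT uU MD s0 Ts Mx MVx Tx.
apply/eqP; rewrite eq_le Ts//= unitary_norm_adjoint//.
have [->|x0] := eqVneq x 0; first by rewrite normr0 mulr0.
have nx : 0 < `|x| by rewrite normr_gt0.
have [|y hy] := compact_operator_cluster cT
    (u := fun k => `|x|^-1 *: iter k U x).
  move=> k; rewrite normrZ unitary_iter_norm// normfV normr_id.
  by rewrite mulVf ?gt_eqF.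
have [C [C0 TC]] := bop_bound T.
apply/ler_addgt0Pr => e e0.
(* Chosen so that [2 * r * |x| = s * (e / (C + 1))]. *)
pose r : R := e / (2 * (C + 1) * `|x|) * s.
have r0 : 0 < r by rewrite mulr_gt0// divr_gt0// !mulr_gt0//; lra.
have [p _ hp] := hy r 0 r0.
(* Starting at [p.+1] forces [q > p], so that the isometry [U ^ p.+1] can be cancelled from the
   difference. *)
have [q pq hq] := hy r p.+1 r0.
have close : `|iter q U x - iter p U x| <= e / (C + 1).
  have : s * `|iter q U x - iter p U x| <=
      `|T (iter q U x) - T (iter p U x)|.
    have := almost_isometric_near_norm MD (ltW s0) Ts (Mx q) (Mx p).
    rewrite !Tx !unitary_iter_norm// exprMn !subrr !mulr0 !addr0 -exprMn.
    by rewrite ler_pXn2r ?nnegrE ?mulr_ge0 ?(ltW s0)//.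
  have : `|T (iter q U x) - T (iter p U x)| <= 2 * r * `|x|.
    have h : `| `|x|^-1 *: (T (iter q U x) - T (iter p U x))| <= 2 * r.
      rewrite scalerBr -!bopZ -[T (_ *: iter q U x)](subrK y) -addrA.
      rewrite (le_trans (ler_normD _ _))// mulr_natl mulr2n lerD//.
        exact: ltW.
      by rewrite distrC ltW.
    by move: h; rewrite normrZ normfV normr_id ler_pdivrMl// mulrC.
  move=> h1 h2; rewrite -(ler_pM2l s0) (le_trans h2)// (le_trans h1)//.
  rewrite le_eqVlt; apply/orP; left; apply/eqP; rewrite /r; field.
  by rewrite !gt_eqF//; lra.
have [k qE] : exists k, q = (p + k.+1)%N.
  by exists (q - p.+1)%N; rewrite addnS -addSn subnKC.
have {}close : `|iter k U x - adjoint U x| <= e / (C + 1).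
  suff <- : `|iter q U x - iter p U x| = `|iter k U x - adjoint U x| by [].
  have iterB l a b : iter l U a - iter l U b = iter l U (a - b).
    by elim: l => //= l <-; rewrite bopB.
  rewrite qE iterD iterB unitary_iter_norm//=.
  by rewrite -[X in _ - X](unitaryKV uU) -bopB unitary_norm.
have : `|T (iter k U x)| <= `|T (adjoint U x)| + C * (e / (C + 1)).
  rewrite -{1}(subrK (adjoint U x) (iter k U x)) bopD addrC.
  rewrite (le_trans (ler_normD _ _))// lerD2l (le_trans (TC _))//.
  by rewrite ler_wpM2l.
rewrite Tx.
have : C * (e / (C + 1)) <= e.
  by rewrite mulrCA ger_pMr// ler_pdivrMr ?mul1r; lra.
lra.
Qed.

Definition orthocomplement W : set H :=
  [set x | forall w, W w -> inner x w = 0].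

(** For [x] orthogonal to [w], [inner z w = inner (z - x) w], which is small by Cauchy-Schwarz. *)
Lemma orthocomplement_closed W : closed (orthocomplement W).
Proof.
move=> z /closureP_norm zW w Ww; apply/eqP; rewrite -normr_le0.
apply/ler_addgt0Pr => e e0; rewrite add0r.
have w1 : 0 < `|w| + 1 by rewrite ltr_wpDl.
have [x Wx zx] := zW _ (divr_gt0 e0 w1).
have -> : inner z w = inner (z - x) w by rewrite innerDl innerNl Wx// subr0.
have le_e (v : H) : `|v| = `|z - x| -> inner v w <= e.
  move=> vE; apply: (le_trans (Defs.CauchySchwarz _ _)); rewrite vE.
  apply: (@le_trans _ _ (e / (`|w| + 1) * (`|w| + 1))).
    by rewrite ler_pM ?(ltW zx) ?lerDl.
  by rewrite divfK ?gt_eqF.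
by rewrite ler_norml lerNl -innerNl !le_e ?normrN.
Qed.

Lemma orthocomplementD W x y :
  orthocomplement W x -> orthocomplement W y -> orthocomplement W (x + y).
Proof. by move=> Wx Wy w Ww; rewrite innerDl Wx// Wy// addr0. Qed.

Lemma orthocomplementZ W (k : R) x :
  orthocomplement W x -> orthocomplement W (k *: x).
Proof. by move=> Wx w Ww; rewrite innerZl Wx// mulr0. Qed.

(* Let [W] be the union of the sets invariant under all [U i] and [(U i)^*] on
   which [K] commutes with the [U i].  If some commutator [D] of [K] with [U i]
   is nonzero, the range of [D^*] shows that [W] has a nonzero orthogonal
   complement [M].  The vectors of [M] on which [K] attains its norm on [M]
   form a nonzero invariant set, and by strict convexity of the norm [K]
   commutes with the [U i] on it, so that it meets [M] inside [W]. *)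
Lemma Ad_convex_comb_compact (I : finType) (t : I -> R) (U : I -> 'B(H)) K :
  compact_operator K -> (forall i, unitary (U i)) ->
  (forall i, 0 < t i) -> \sum_i t i = 1 ->
  K = \sum_i t i *: Ad (U i) K -> forall i, Ad (U i) K = K.
Proof.
move=> cK uU t0 t1 KE.
suff KU i x : K (U i x) = U i (K x).
  by move=> i; apply: bopP => x; rewrite AdE KU unitaryK.
pose commuting (V : set H) := forall x, V x -> forall i,
  [/\ V (U i x), V (adjoint (U i) x) & K (U i x) = U i (K x)].
pose W : set H := [set x | exists2 V, commuting V & V x].
pose M := orthocomplement W.
have MU j z : M z -> M (U j z).
  move=> Mz w [V cV Vw]; rewrite adjointP; apply: Mz.
  by exists V => //; have [] := cV _ Vw j.
have MV j z : M z -> M (adjoint (U j) z).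
  move=> Mz w [V cV Vw]; rewrite -adjointPr; apply: Mz.
  by exists V => //; have [] := cV _ Vw j.
(* Both contradictions below come from a nonzero vector of [M] shown to lie in [W]. *)
have MW0 z : M z -> W z -> z = 0 by move=> Mz /Mz/inner_eq0.
have [C [C0 KC]] := bop_bound K.
pose S : set R := [set `|K z| | z in [set z | M z /\ `|z| <= 1]].
have M0 : M 0 by move=> w _; rewrite inner0l.
have hS : has_sup S.
  split; first by exists `|K 0|, 0 => //; split=> //; rewrite normr0.
  exists C => _ [z [_ z1] <-]; apply: (le_trans (KC z)).
  by rewrite ler_piMr.
pose s := sup S.
have s_ge z : M z -> `|z| <= 1 -> `|K z| <= s.
  by move=> Mz z1; apply: ub_le_sup; [exact: hS.2|exists z].
have Ks z : M z -> `|K z| <= s * `|z|.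
  move=> Mz; have [->|z0] := eqVneq z 0.
    by rewrite bop0 normr0 mulr0.
  have nz : 0 < `|z| by rewrite normr_gt0.
  have := s_ge (`|z|^-1 *: z) (orthocomplementZ _ Mz).
  rewrite bopZ !normrZ normfV normr_id mulVf ?gt_eqF// => /(_ (lexx _)).
  by rewrite ler_pdivrMl// mulrC.
apply: contrapT => KU.
have [m Mm m0] : exists2 m, M m & m != 0.
  pose D : 'B(H) := K * U i - U i * K.
  have DE z : D z = K (U i z) - U i (K z).
    by rewrite /D -[LHS]/(_ + _) -[X in _ + X]/(-1 *: _) scaleN1r.
  (* [D] vanishes on [W], so the range of [adjoint D] is orthogonal to [W]; if this vector were 0,
     so would be [|D x|^2]. *)
  exists (adjoint D (D x)).
    move=> w [V cV Vw]; rewrite -adjointPr (DE w).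
    by have [_ _ ->] := cV _ Vw i; rewrite subrr innerC inner0l.
  apply: contra_notN KU => /eqP h.
  apply/eqP; rewrite -subr_eq0 -DE; apply/eqP/inner_eq0.
  by rewrite adjointP h innerC inner0l.
have s0 : 0 <= s by apply: le_trans (s_ge 0 M0 _); rewrite ?normr0.
move: s0; rewrite le_eqVlt => /predU1P[s0|s0].
  (* Case [s = 0]: [K] vanishes on [M], so [M] itself is a commuting invariant set and [m] lies in
     [W]. *)
  have K0 z : M z -> K z = 0.
    by move=> /Ks; rewrite -s0 mul0r normr_le0 => /eqP.
  suff Wm : W m by rewrite (MW0 _ Mm Wm) eqxx in m0.
  exists M => // z Mz j; split; [exact: MU|exact: MV|].
  by rewrite !K0 ?bop0//; exact: MU.
have [|y [My y0 Ky]] := compact_operator_norm_attained cK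
    (@orthocomplement_closed W) (@orthocomplementD W) s0 Ks.
  move=> e e0; have [_ [z [Mz z1] <-] h] := sup_adherent e0 hS.
  by exists z.
pose E : set H := [set z | M z /\ `|K z| = s * `|z|].
suff Wy : W y by rewrite (MW0 _ My Wy) eqxx in y0.
exists E; last by [].
have EU z : E z -> forall j, E (U j z) /\ K (U j z) = U j (K z).
  move=> [Mz Kz] j.
  (* [K z] is an average of such vectors, none longer than [s * |z| = |K z|]. *)
  have KUz : adjoint (U j) (K (U j z)) = K z.
    apply: (convex_comb_extreme (t := t)
      (v := fun j => adjoint (U j) (K (U j z)))) => //.
      by rewrite {1}KE bop_sumE.
    move=> l; rewrite unitary_norm_adjoint// Kz.
    by rewrite -(unitary_norm (uU l) z) Ks//; exact: MU.
  have KUz' : K (U j z) = U j (K z) by rewrite -KUz unitaryKV.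
  split=> //; split; first exact: MU.
  by rewrite KUz' !(unitary_norm (uU j)).
move=> z Ez j; have [EUz KUz] := EU z Ez j; split=> //.
(* Averaging gives invariance of [E] under [U j] only; the adjoint is reached through the forward
   orbit of [z]. *)
have Eiter k : E (iter k (U j) z).
  by elim: k => //= k IH; have [] := EU _ IH j.
split; first by apply: MV; exact: Ez.1.
apply: (norm_attained_unitary_inv cK (uU j) (@orthocomplementD W) s0 Ks).
- by move=> k; exact: (Eiter k).1.
- exact: MV Ez.1.
- by move=> k; rewrite (Eiter k).2 unitary_iter_norm.
Qed.

End Commutation.

(** * Compactness of all operators in finite dimension *)

Section FiniteDimension.
Variables (R : realType) (H : hilbertType R).

Lemma Gram_Schmidt n (e : 'I_n -> H) : exists m (f : 'I_m -> H),
  (forall i j, inner (f i) (f j) = (i == j)%:R) /\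
  (forall i, e i = \sum_j inner (e i) (f j) *: f j).
Proof.
elim: n e => [|n IH] e; first by exists 0, (fun=> 0); split=> -[].
have [m [f [fo fe]]] := IH (e \o lift ord0).
pose p := \sum_j inner (e ord0) (f j) *: f j.
have [v0|v0] := eqVneq (e ord0 - p) 0.
  exists m, f; split=> // i; case: (unliftP ord0 i) => [k ->|->].
    exact: fe.
  exact: subr0_eq v0.
set v := e ord0 - p in v0.
have nv : `|v| != 0 by rewrite normr_eq0.
have vf j : inner v (f j) = 0.
  rewrite /v innerDl innerNl /p inner_suml (bigD1 j)//= innerZl fo eqxx mulr1.
  rewrite big1 ?addr0 ?subrr// => k /negPf kj.
  by rewrite innerZl fo kj mulr0.
pose g (i : 'I_m.+1) := oapp f (`|v|^-1 *: v) (unlift ord0 i).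
have gl k : g (lift ord0 k) = f k by rewrite /g liftK.
have gm : g ord0 = `|v|^-1 *: v by rewrite /g unlift_none.
exists m.+1, g; split=> [i j|i].
  case: (unliftP ord0 i) => [k ->|->]; case: (unliftP ord0 j) => [l ->|->].
  - by rewrite !gl fo (inj_eq lift_inj).
  - by rewrite gl gm innerZr innerC vf mulr0 eq_sym (negPf (neq_lift _ _)).
  - by rewrite gl gm innerZl vf mulr0 (negPf (neq_lift _ _)).
  - by rewrite gm innerZl innerZr inner_norm eqxx mulr1n; field.
rewrite big_ord_recl gm; under eq_bigr do rewrite gl.
case: (unliftP ord0 i) => [k ->|->].
  rewrite -fe /= innerZr innerC.
  suff -> : inner v (e (lift ord0 k)) = 0 by rewrite mulr0 scale0r add0r.
  have /= -> := fe k.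
  rewrite innerC inner_suml big1// => j _.
  by rewrite innerZl (innerC _ v) vf mulr0.
rewrite -/p scalerA innerZr.
have -> : inner (e ord0) v = `|v| ^+ 2.
  rewrite -inner_norm {2}/v innerDl innerNl.
  have -> : inner p v = 0; last by rewrite subr0.
  by rewrite inner_suml big1// => j _; rewrite innerZl (innerC _ v) vf mulr0.
have -> : `|v|^-1 * `|v| ^+ 2 * `|v|^-1 = 1 by field.
by rewrite scale1r /v subrK.
Qed.

(** In orthonormal coordinates the unit ball lies in the cube [[-1, 1]^m], whose continuous image is
    compact. *)
Lemma finite_dimensional_compact_operator (T : 'B(H)) :
  finite_dimensional H -> compact_operator T.
Proof.
move=> [n [e eH]]; have [m [f [fo fe]]] := Gram_Schmidt e.
have fH x : x = \sum_j inner x (f j) *: f j.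
  have [c ->] := eH x.
  under [RHS]eq_bigr => j _ do rewrite inner_suml scaler_suml.
  rewrite [RHS]exchange_big /=; apply: eq_bigr => i _.
  rewrite {1}(fe i) scaler_sumr; apply: eq_bigr => j _.
  by rewrite innerZl scalerA.
have fn j : `|f j| = 1.
  apply/eqP; rewrite -(eqrXn2 (ltn0Sn 1))// expr1n -inner_norm.
  by rewrite fo eqxx.
pose F (c : 'rV[R]_m) : H := \sum_j c ord0 j *: T (f j).
have Fc : continuous F.
  move=> c; apply: (@cvg_big _ _ _ _ _ (@add_continuous H) _ (nbhs c)) => j _.
  by apply: cvgZr_tmp; exact: coord_continuous.
have bc : compact [set c : 'rV[R]_m | forall j, `[-1, 1]%classic (c ord0 j)].
  exact: (@rV_compact R m (fun=> `[-1, 1]%classic)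
    (fun=> @segment_compact R _ _)).
exists (F @` [set c : 'rV[R]_m | forall j, `[-1, 1]%classic (c ord0 j)]).
  move=> _ [x /= x1 <-]; exists (\row_j inner x (f j)) => /=.
    move=> j; rewrite mxE in_itv /= -ler_norml.
    have le1 (y : H) : `|y| <= 1 -> inner y (f j) <= 1.
      by move=> y1; rewrite (le_trans (Defs.CauchySchwarz _ _))// fn mulr1.
    by rewrite ler_norml lerNl -innerNl !le1 ?normrN.
  rewrite {2}(fH x) /F (big_morph T (bopD T) (bop0 T)).
  by apply: eq_bigr => j _; rewrite mxE bopZ.
have Kc := continuous_compact (continuous_subspaceT Fc) bc.
by split=> //; apply: compact_closed => //; exact: norm_hausdorff.
Qed.

End FiniteDimension.

(** * From C*-extreme points to linear extreme points *)

Section ConvexCombinations.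
Variables (R : realType) (A : realCstarAlgType R) (H : hilbertType R).

Lemma Ad_scalar_plus (T K : 'B(H)) (c : R) :
  unitary T -> Ad T (K + c *: (1 : 'B(H))) = Ad T K + c *: (1 : 'B(H)).
Proof.
by move=> uT; apply: bopP => x; rewrite AdE /= bopD bopZ unitaryK.
Qed.

(* The operators [sqrt (t j) *: 1] turn a convex combination into a
   C*-convex one. *)
Lemma UCP_Cstar_ext_convex_comb (Phi : {linear A -> 'B(H)}) n
    (Psi : 'I_n -> {linear A -> 'B(H)}) (t : 'I_n -> R) :
  UCP_Cstar_ext A H Phi -> (forall j, UCP A H (Psi j)) ->
  (forall j, 0 < t j) -> \sum_(j < n) t j = 1 ->
  (forall a, Phi a = \sum_(j < n) t j *: Psi j a) ->
  forall j, exists U : 'B(H), unitary U /\ Psi j =1 Ad U \o Phi.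
Proof.
move=> [_ ext] PsiU t0 t1 PhiE.
pose T j : 'B(H) := Num.sqrt (t j) *: (1 : 'B(H)).
have AdT j X : Ad (T j) X = t j *: X.
  apply: bopP => x; rewrite AdE /T adjointZ adjoint1 /= bopZ scalerA.
  by rewrite -expr2 sqr_sqrtr// ltW.
have rt j : Num.sqrt (t j) != 0 by rewrite gt_eqF// sqrtr_gt0.
apply: (ext n Psi T) => //.
- move=> j; exists ((Num.sqrt (t j))^-1 *: (1 : 'B(H))).
  by split; apply: bopP => x /=; rewrite scalerA ?mulVf ?mulfV// scale1r.
- apply: bopP => x; rewrite bop_sumE -[RHS]scale1r -t1 scaler_suml.
  apply: eq_bigr => j _; exact: (congr1 (fun S : 'B(H) => S x) (AdT j 1)).
- by move=> a; rewrite PhiE; apply: eq_bigr => j _; rewrite AdT.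
Qed.

(** With [Phi a = K + c *: 1], unitary conjugation fixes the scalar part, which cancels from the
    convex combination and leaves [K] as a convex combination of the [Ad (U j) K]. *)
Lemma UCP_Cstar_ext_compact_UCP_ext (Phi : {linear A -> 'B(H)}) :
  UCP_Cstar_ext A H Phi ->
  range Phi `<=` [set K + c *: (1 : 'B(H)) |
                    K in [set K | compact_operator K] & c in [set: R]] ->
  UCP_ext A H Phi.
Proof.
move=> ext PhiK; split; first by case: ext.
move=> n Psi t PsiU t01 t1 PhiE.
have t0 j : 0 < t j by have /andP[] := t01 j.
have /choice[U hU] := UCP_Cstar_ext_convex_comb ext PsiU t0 t1 PhiE.
have uU j : unitary (U j) by have [] := hU j.
move=> j a; have [K cK [c _ KE]] := PhiK _ (ex_intro2 _ _ a I erefl).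
have [_ ->] := hU j; rewrite /= -KE Ad_scalar_plus//; congr (_ + _).
move: j; apply: (Ad_convex_comb_compact cK uU t0 t1).
apply: (addIr (c *: (1 : 'B(H)))); rewrite {1}KE PhiE.
have -> : c *: (1 : 'B(H)) = \sum_j t j *: (c *: (1 : 'B(H))).
  by rewrite -scaler_suml t1 scale1r.
rewrite -big_split /=; apply: eq_bigr => j _.
have [_ ->] := hU j; rewrite /= -KE Ad_scalar_plus//.
exact: scalerDr.
Qed.

End ConvexCombinations.

Theorem proposition3p8 (R : realType) (A : realCstarAlgType R)
    (H : hilbertType R) :
  (forall Phi : {linear A -> 'B(H)},
     UCP_Cstar_ext A H Phi ->
     range Phi `<=` [set K + c *: (1 : 'B(H)) |
                       K in [set K | compact_operator K] & c in [set: R]] ->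
     UCP_ext A H Phi) /\
  (finite_dimensional H -> UCP_Cstar_ext A H `<=` UCP_ext A H).
Proof.
split=> [Phi|fH Phi ext]; first exact: UCP_Cstar_ext_compact_UCP_ext.
apply: UCP_Cstar_ext_compact_UCP_ext ext _ => _ [a _ <-].
exists (Phi a); first exact: finite_dimensional_compact_operator.
by exists 0; rewrite ?scale0r ?addr0.
Qed.
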